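(* Let $T:C^1[0,1]\to C^1[0,1]$ be an isometric reflection of Form (IV), i.e. there are $c\in\mathbb{C}$ with $|c|=1$, a continuous function $\beta:[0,1]\to\mathbb{C}$ with $|\beta(t)|=1$ for all $t$, and a homeomorphism $\phi:[0,1]\to[0,1]$ such that $$T(f)(t)=T(0)(t)+c\,\overline{f(0)}+\int_0^t\beta(s)\overline{f'(\phi(s))}\,ds$$ for every $f\in C^1[0,1]$ and $t\in[0,1]$. Then $\beta(t)\overline{\beta(\phi(t))}=1$ and $\phi^2(t)=t$ for every $t\in[0,1]$.
   Context: $C^1[0,1]$ is the complex linear space of continuously differentiable complex-valued functions on $[0,1]$ with the norm $\|f\|_\sigma=|f(0)|+\|f'\|_\infty$. An isometry is a map $T$ (not assumed linear) with $\|Tf-Tg\|_\sigma=\|f-g\|_\sigma$ for all $f,g$; it is an isometric reflection if $T^2=T\circ T=I$, the identity map. $T(0)\in C^1[0,1]$ denotes the image of the zero function, and $\phi^2=\phi\circ\phi$. *)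

(* Defs.v *)
From Stdlib Require Import Reals Lra.
From Coquelicot Require Import Coquelicot.

Open Scope R_scope.

Definition I01 : Type := {t : R | 0 <= t <= 1}.

Definition I01_val (t : I01) : R := proj1_sig t.
Coercion I01_val : I01 >-> R.

Lemma clamp_bounds (x : R) : 0 <= Rmax 0 (Rmin x 1) <= 1.
Proof.
unfold Rmax, Rmin.
destruct (Rle_dec x 1); match goal with |- context [Rle_dec 0 ?y] =>
  destruct (Rle_dec 0 y) end; lra.
Qed.

(** The retraction of the line onto [0,1]. It turns a function on [I01] into
    a function on [R], the form that [RInt] expects; on [0,1] it changes
    nothing, so the integrals below only see values on [0,1]. *)
Definition clamp (x : R) : I01 := exist _ (Rmax 0 (Rmin x 1)) (clamp_bounds x).

Lemma clamp_val (x : R) : 0 <= x <= 1 -> I01_val (clamp x) = x.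
Proof.
intros Hx; unfold clamp, I01_val, Rmax, Rmin; simpl.
destruct (Rle_dec x 1); match goal with |- context [Rle_dec 0 ?y] =>
  destruct (Rle_dec 0 y) end; lra.
Qed.

Lemma I01_0_bounds : 0 <= 0 <= 1. Proof. lra. Qed.
Definition I01_0 : I01 := exist _ 0 I01_0_bounds.

Definition I01_UniformSpace_mixin : UniformSpace.mixin_of I01 :=
  UniformSpace.Mixin I01 I01_0
    (fun (x : I01) e (y : I01) => ball (x : R) e (y : R))
    (fun x e => ball_center (x : R) e)
    (fun x y e => ball_sym (x : R) (y : R) e)
    (fun x y z e1 e2 => ball_triangle (x : R) (y : R) (z : R) e1 e2).

Canonical I01_UniformSpace :=
  UniformSpace.Pack I01 I01_UniformSpace_mixin I01.

Definition homeomorphism (phi : I01 -> I01) : Prop :=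
  (forall t : I01, continuous phi t) /\
  exists psi : I01 -> I01,
    (forall t : I01, continuous psi t) /\
    (forall t : I01, psi (phi t) = t) /\
    (forall t : I01, phi (psi t) = t).

(** [locally' t] consists of the punctured neighbourhoods of [t] inside [0,1],
    so that the derivative is one-sided at 0 and at 1. *)
Definition is_deriv01 (f : I01 -> C) (t : I01) (l : C) : Prop :=
  filterlim (fun s : I01 => ((f s - f t) / RtoC (s - t))%C)
    (locally' t) (locally l).

(** The value of the derivative, by definite description as in [RInt];
    meaningful where [f] is differentiable. *)
Definition deriv01 (f : I01 -> C) (t : I01) : C :=
  @iota C_R_CompleteNormedModule (is_deriv01 f t).

Definition is_C1 (f : I01 -> C) : Prop :=
  exists g : I01 -> C,
    (forall t : I01, is_deriv01 f t (g t)) /\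
    (forall t : I01, continuous g t).

Record C1_01 : Type := mkC1 {
  C1_fun :> I01 -> C;
  C1_prop : is_C1 C1_fun
}.

Lemma is_C1_zero : is_C1 (fun _ => RtoC 0).
Proof.
exists (fun _ => RtoC 0); split; intros t.
- apply filterlim_ext with (fun _ : I01 => RtoC 0).
  + intros s; unfold Cdiv; ring.
  + apply filterlim_const.
- apply filterlim_const.
Qed.

Definition C1_zero : C1_01 := mkC1 (fun _ => RtoC 0) is_C1_zero.

Lemma C_filterlim_minus {U : Type} (F : (U -> Prop) -> Prop) {FF : Filter F}
    (f g : U -> C) (a b : C) :
  filterlim f F (locally a) -> filterlim g F (locally b) ->
  filterlim (fun x => (f x - g x)%C) F (locally (a - b)%C).
Proof.
intros Hf Hg.
apply (filterlim_comp_2 (G := locally a) (H := locally (Copp b))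
  f (fun x => Copp (g x)) Cplus).
- exact Hf.
- apply (filterlim_comp _ _ _ g Copp F (locally b)).
  + exact Hg.
  + exact (@filterlim_opp R_AbsRing C_R_NormedModule b).
- exact (@filterlim_plus R_AbsRing C_R_NormedModule a (Copp b)).
Qed.

Lemma is_C1_minus (f g : I01 -> C) :
  is_C1 f -> is_C1 g -> is_C1 (fun t => (f t - g t)%C).
Proof.
intros [f' [Df Cf]] [g' [Dg Cg]].
exists (fun t => (f' t - g' t)%C); split; intros t.
- apply filterlim_ext with
    (fun s : I01 => ((f s - f t) / RtoC (s - t) - (g s - g t) / RtoC (s - t))%C).
  + intros s; unfold Cdiv; ring.
  + apply C_filterlim_minus; [apply within_filter, locally_filter | apply Df | apply Dg].
- apply C_filterlim_minus; [apply locally_filter | apply Cf | apply Cg].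
Qed.

Definition C1_minus (f g : C1_01) : C1_01 :=
  mkC1 (fun t => (f t - g t)%C) (is_C1_minus f g (C1_prop f) (C1_prop g)).

Definition sup_norm (g : I01 -> C) : R :=
  real (Lub_Rbar (fun r => exists t : I01, r = Cmod (g t))).

Definition norm_sigma (f : C1_01) : R :=
  Cmod (f I01_0) + sup_norm (deriv01 f).

Definition isometry (T : C1_01 -> C1_01) : Prop :=
  forall f g : C1_01,
    norm_sigma (C1_minus (T f) (T g)) = norm_sigma (C1_minus f g).

Definition isometric_reflection (T : C1_01 -> C1_01) : Prop :=
  isometry T /\ forall f : C1_01, T (T f) = f.

Definition form_IV (T : C1_01 -> C1_01) (c : C) (beta : I01 -> C)
    (phi : I01 -> I01) : Prop :=
  forall (f : C1_01) (t : I01),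
    T f t = (T C1_zero t + c * Cconj (f I01_0) +
      @RInt C_R_CompleteNormedModule
        (fun s => beta (clamp s) * Cconj (deriv01 f (phi (clamp s)))) 0 t)%C.

(* Main.v *)
Require Import Defs.
From Stdlib Require Import Reals Lra ProofIrrelevance.
From Coquelicot Require Import Coquelicot.

(** Passing to derivatives turns the integral formula for [T] into the pointwise
    identity [(T f)' = (T 0)' + beta * conj (f' o phi)], by the fundamental
    theorem of calculus on [0,1] ([is_deriv01_RInt], [form_IV_deriv01]).
    Using it twice in [T (T f) = f], and once more for [f = 0] to eliminate
    the terms with [(T 0)'], gives for every [f]
      [f' = beta * conj (beta o phi) * (f' o phi o phi)]
    ([involutive_form_IV_deriv01]). Two test functions then suffice:
    [f(x) = x] yields [beta * conj (beta o phi) = 1], and afterwards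
    [f(x) = x^2] yields [2 t = 2 phi (phi t)].

    Limits of difference quotients on [0,1] are unique, so the derivative given
    by definite description can be computed from any of them; in particular it
    is continuous on [C^1] functions, as the fundamental theorem requires. *)

Local Notation CR := C_R_CompleteNormedModule.

(** * Topology of [0,1] and of the complex plane *)

Lemma I01_ext (s t : I01) : I01_val s = I01_val t -> s = t.
Proof.
destruct s as [s Hs], t as [t Ht]; simpl; intros <-.
f_equal; apply proof_irrelevance.
Qed.

Lemma I01_sub_neq_0 (s t : I01) : s <> t -> RtoC (s - t) <> RtoC 0.
Proof.
intros Hst H; apply Hst, I01_ext.
apply (f_equal fst) in H; simpl in H; lra.
Qed.

Lemma clamp_I01 (t : I01) : clamp t = t.
Proof. apply I01_ext, clamp_val, (proj2_sig t). Qed.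

Lemma continuous_clamp (x : R) : continuous clamp x.
Proof.
apply filterlim_locally; intros eps; exists eps; intros y Hy.
change (Rabs (y - x) < eps) in Hy.
change (Rabs (Rmax 0 (Rmin y 1) - Rmax 0 (Rmin x 1)) < eps).
revert Hy; unfold Rmax, Rmin.
repeat destruct Rle_dec; unfold Rabs; repeat destruct Rcase_abs; lra.
Qed.

Lemma continuous_I01_val (t : I01) : continuous I01_val t.
Proof. intros P [eps HP]; exists eps; intros s Hs; apply HP, Hs. Qed.

Lemma continuous_RtoC (x : R) : continuous RtoC x.
Proof.
apply filterlim_locally; intros eps; exists eps; intros y Hy.
split; [exact Hy | apply ball_center].
Qed.

Lemma continuous_Cconj (z : C) : continuous Cconj z.
Proof.
apply filterlim_locally; intros eps; exists eps; intros w [H1 H2].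
split; [exact H1 |].
change (Rabs (snd w - snd z) < eps) in H2.
change (Rabs (- snd w - - snd z) < eps).
replace (- snd w - - snd z) with (- (snd w - snd z)) by ring.
now rewrite Rabs_Ropp.
Qed.

(** The product of [C] is continuous for the topology of its absolute value,
    while here [C] carries the product topology of the plane; the two
    have the same neighbourhoods. *)
Lemma continuous_Cmult {U : UniformSpace} (f g : U -> C) (x : U) :
  continuous f x -> continuous g x -> continuous (fun u => (f u * g u)%C) x.
Proof.
assert (Htop : forall h : U -> C,
  continuous h x <-> @continuous U (AbsRing_UniformSpace C_AbsRing) h x).
{ intros h; split; intros H P HP; apply H; now apply locally_C. }
intros Hf Hg; apply Htop.
now apply (@continuous_mult U C_AbsRing f g x); apply Htop.
Qed.

(** * Derivatives on [0,1] *)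

(** A point of [0,1] is never isolated, so limits along its punctured
    neighbourhoods are unique. *)
Lemma locally'_I01_proper (t : I01) : ProperFilter (locally' t).
Proof.
split; [| apply within_filter, locally_filter].
intros P [eps HP].
assert (He := cond_pos eps); assert (Ht := proj2_sig t).
change (0 <= I01_val t <= 1) in Ht.
(* The half containing [t] decides the direction of a step; one of length at
   most 1/2 then stays inside [0,1]. *)
set (d := Rmin (eps / 2) (1 / 2)).
assert (Hd : 0 < d <= 1 / 2 /\ d < eps).
{ unfold d, Rmin; destruct Rle_dec; lra. }
assert (Hs : exists r, 0 <= r <= 1 /\ Rabs (r - t) = d).
{ destruct (Rle_dec t (1 / 2)).
  - exists (t + d); split; [lra |].
    replace (t + d - t) with d by ring; apply Rabs_pos_eq; lra.
  - exists (t - d); split; [lra |].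
    replace (t - d - t) with (- d) by ring.
    rewrite Rabs_Ropp; apply Rabs_pos_eq; lra. }
destruct Hs as [r [Hr Hrd]].
exists (exist _ r Hr : I01); apply HP.
- change (Rabs (r - t) < eps); lra.
- intros E; rewrite <- E in Hrd; unfold I01_val in Hrd; simpl in Hrd.
  rewrite Rminus_diag, Rabs_R0 in Hrd; lra.
Qed.

Lemma deriv01_unique (f : I01 -> C) (t : I01) (l : C) :
  is_deriv01 f t l -> deriv01 f t = l.
Proof.
intros H.
assert (P := locally'_I01_proper t).
exact (@iota_filterlim_locally R_AbsRing CR I01 (locally' t) _ _ l H).
Qed.

Lemma is_deriv01_deriv01 (f : C1_01) (t : I01) : is_deriv01 f t (deriv01 f t).
Proof.
destruct (C1_prop f) as [g [Dg _]].
rewrite (deriv01_unique _ _ _ (Dg t)); apply Dg.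
Qed.

Lemma continuous_deriv01 (f : C1_01) (t : I01) : continuous (deriv01 f) t.
Proof.
destruct (C1_prop f) as [g [Dg Cg]].
apply (continuous_ext g); [| apply Cg].
intros s; symmetry; apply deriv01_unique, Dg.
Qed.

Lemma is_deriv01_const (a : C) (t : I01) : is_deriv01 (fun _ => a) t (RtoC 0).
Proof.
apply filterlim_ext with (fun _ : I01 => RtoC 0); [| apply filterlim_const].
intros s; unfold Cdiv; ring.
Qed.

Lemma is_deriv01_plus (f g : I01 -> C) (t : I01) (l m : C) :
  is_deriv01 f t l -> is_deriv01 g t m ->
  is_deriv01 (fun s => (f s + g s)%C) t (l + m)%C.
Proof.
intros Hf Hg.
apply filterlim_ext with
  (fun s : I01 => ((f s - f t) / RtoC (s - t) + (g s - g t) / RtoC (s - t))%C).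
- intros s; unfold Cdiv; ring.
- assert (P := locally'_I01_proper t).
  exact (filterlim_comp_2 _ _ _ Hf Hg (@filterlim_plus R_AbsRing C_R_NormedModule l m)).
Qed.

(** Restricting a differentiable curve on the line to [0,1] turns its
    first-order expansion at a point into convergence of difference
    quotients. *)
Lemma is_deriv01_of_is_derive (F : R -> C) (t : I01) (l : C) :
  @is_derive R_AbsRing C_R_NormedModule F t l ->
  is_deriv01 (fun s => F s) t l.
Proof.
intros [_ HF].
specialize (HF (t : R) (fun P HP => HP)).
apply filterlim_locally; intros eps.
(* The expansion bounds the quotient by a non-strict inequality; halving
   the radius makes it strict. *)
assert (He := cond_pos eps).
assert (He2 : 0 < eps / 2) by lra.
specialize (HF (mkposreal _ He2)); simpl in HF.
apply (continuous_I01_val t) in HF; unfold filtermap in HF.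
unfold locally', within.
refine (@filter_imp I01 (locally t) _ _ _ _ HF).
intros s Hs Hst.
apply (@norm_compat1 R_AbsRing C_R_NormedModule).
change C with (NormedModule.sort R_AbsRing C_R_NormedModule) in *.
rewrite <- Cmod_norm in *.
assert (Hn := I01_sub_neq_0 s t Hst).
assert (Hpos := proj1 (Cmod_gt_0 _) Hn).
apply Rle_lt_trans with (eps / 2); [| lra].
apply Rmult_le_reg_r with (1 := Hpos).
rewrite <- Cmod_mult.
eapply Rle_trans; [| eapply Rle_trans; [exact Hs |]].
- right; f_equal.
  transitivity ((F s - F t) - l * RtoC (s - t))%C.
  + change (((F s - F t) / RtoC (s - t) - l) * RtoC (s - t)
            = (F s - F t) - l * RtoC (s - t))%C.
    field; exact Hn.
  + apply injective_projections; simpl;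
      unfold minus, plus, opp, scal, mult; simpl; unfold mult; simpl; ring.
- right; f_equal; symmetry; apply Cmod_R.
Qed.

(** The fundamental theorem of calculus for [C]-valued integrands. Extending
    the integrand to the line through [clamp] keeps it continuous, so that
    the two-sided theorem applies at the endpoints as well. *)
Lemma is_deriv01_RInt (h : I01 -> C) (t : I01) :
  (forall s, continuous h s) ->
  is_deriv01 (fun s => @RInt CR (fun x => h (clamp x)) 0 s) t (h t).
Proof.
intros Hh.
assert (Hc : forall x : R, continuous (fun x => h (clamp x)) x).
{ intros x; apply continuous_comp; [apply continuous_clamp | apply Hh]. }
apply (is_deriv01_of_is_derive (fun y => @RInt CR (fun x => h (clamp x)) 0 y)).
rewrite <- (clamp_I01 t) at 2.
apply (@is_derive_RInt C_R_NormedModule (fun x => h (clamp x))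
  (fun y => @RInt CR (fun x => h (clamp x)) 0 y) 0 t); [| apply Hc].
apply filter_forall; intros y.
apply (@RInt_correct CR), (@ex_RInt_continuous CR); intros z _; apply Hc.
Qed.

Lemma is_deriv01_id (t : I01) : is_deriv01 (fun s => RtoC s) t (RtoC 1).
Proof.
apply filterlim_within_ext with (fun _ => RtoC 1); [| apply filterlim_const].
intros s Hs; rewrite <- RtoC_minus.
field; exact (I01_sub_neq_0 s t Hs).
Qed.

Lemma is_deriv01_sqr (t : I01) :
  is_deriv01 (fun s => RtoC (s * s)) t (RtoC (t + t)).
Proof.
apply filterlim_within_ext with (fun s : I01 => RtoC (s + t)).
- intros s Hs; assert (Hn := I01_sub_neq_0 s t Hs).
  rewrite RtoC_minus in *.
  rewrite RtoC_plus, !RtoC_mult; field; exact Hn.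
- refine (filterlim_filter_le_1 (F := locally t) (G := locally' t)
    (fun s : I01 => RtoC (s + t)) _ _).
  + apply filter_le_within.
  + apply (continuous_comp (fun s : I01 => s + t) RtoC);
      [| apply continuous_RtoC].
    apply (@continuous_plus _ R_AbsRing R_NormedModule);
      [apply continuous_I01_val | apply continuous_const].
Qed.

Lemma is_C1_id : is_C1 (fun s => RtoC s).
Proof.
exists (fun _ => RtoC 1); split; intros t;
  [apply is_deriv01_id | apply continuous_const].
Qed.

Lemma is_C1_sqr : is_C1 (fun s => RtoC (s * s)).
Proof.
exists (fun t => RtoC (t + t)); split; intros t; [apply is_deriv01_sqr |].
apply (continuous_comp (fun s : I01 => s + s) RtoC); [| apply continuous_RtoC].
apply (@continuous_plus _ R_AbsRing R_NormedModule); apply continuous_I01_val.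
Qed.

(** * Form (IV) on derivatives *)

(** Differentiating Form (IV) removes the term with [f 0] and leaves a
    weighted composition operator on derivatives. *)
Lemma form_IV_deriv01 (T : C1_01 -> C1_01) (c : C) (beta : I01 -> C)
    (phi : I01 -> I01) :
  (forall t, continuous beta t) -> (forall t, continuous phi t) ->
  form_IV T c beta phi -> forall (f : C1_01) (t : I01),
  deriv01 (T f) t =
    (deriv01 (T C1_zero) t + beta t * Cconj (deriv01 f (phi t)))%C.
Proof.
intros Hb Hphi HT f t; apply deriv01_unique.
set (h := fun s => (beta s * Cconj (deriv01 f (phi s)))%C).
apply (filterlim_ext (fun s : I01 =>
  ((T C1_zero s + c * Cconj (f I01_0) + @RInt CR (fun x => h (clamp x)) 0 s
   - (T C1_zero t + c * Cconj (f I01_0) + @RInt CR (fun x => h (clamp x)) 0 t))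
   / RtoC (s - t))%C)).
{ intros s; rewrite (HT f s), (HT f t); reflexivity. }
change (is_deriv01 (fun s => (T C1_zero s + c * Cconj (f I01_0) +
  @RInt CR (fun x => h (clamp x)) 0 s)%C) t (deriv01 (T C1_zero) t + h t)%C).
rewrite <- (Cplus_0_r (deriv01 (T C1_zero) t)).
apply is_deriv01_plus; [apply is_deriv01_plus |].
- apply is_deriv01_deriv01.
- apply is_deriv01_const.
- apply is_deriv01_RInt; intros s; apply continuous_Cmult; [apply Hb |].
  apply (continuous_comp (fun s => deriv01 f (phi s)) Cconj);
    [| apply continuous_Cconj].
  apply continuous_comp; [apply Hphi | apply continuous_deriv01].
Qed.

(** In the square of a map of Form (IV) the two conjugations cancel. Both
    summands coming from the image of zero add up to the derivative of
    [T (T 0) = 0], so they vanish. *)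
Lemma involutive_form_IV_deriv01 (T : C1_01 -> C1_01) (c : C)
    (beta : I01 -> C) (phi : I01 -> I01) :
  (forall t, continuous beta t) -> (forall t, continuous phi t) ->
  form_IV T c beta phi -> (forall f, T (T f) = f) ->
  forall (f : C1_01) (t : I01),
  deriv01 f t =
    (beta t * Cconj (beta (phi t)) * deriv01 f (phi (phi t)))%C.
Proof.
intros Hb Hphi HT Hinv.
assert (Hsq : forall (f : C1_01) (t : I01), deriv01 f t =
  (deriv01 (T C1_zero) t + beta t * Cconj (deriv01 (T C1_zero) (phi t)) +
   beta t * Cconj (beta (phi t)) * deriv01 f (phi (phi t)))%C).
{ intros f t; rewrite <- (Hinv f) at 1.
  rewrite !(form_IV_deriv01 T c beta phi Hb Hphi HT (T f)),
    (form_IV_deriv01 T c beta phi Hb Hphi HT f).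
  rewrite Cplus_conj, Cmult_conj, Cconj_conj; ring. }
assert (D0 : forall t, deriv01 C1_zero t = RtoC 0)
  by (intros t; exact (deriv01_unique _ _ _ (is_deriv01_const (RtoC 0) t))).
intros f t.
assert (H0 := Hsq C1_zero t); rewrite !D0, Cmult_0_r, Cplus_0_r in H0.
now rewrite (Hsq f t), <- H0, Cplus_0_l.
Qed.

Theorem theorem2p4 (T : C1_01 -> C1_01) (c : C) (beta : I01 -> C)
    (phi : I01 -> I01)
    (hT : isometric_reflection T)
    (hc : Cmod c = 1%R)
    (hbeta_cont : forall t : I01, continuous beta t)
    (hbeta_mod : forall t : I01, Cmod (beta t) = 1%R)
    (hphi : homeomorphism phi)
    (hform : form_IV T c beta phi) :
  forall t : I01,
    (beta t * Cconj (beta (phi t)))%C = RtoC 1 /\ phi (phi t) = t.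
Proof.
intros t.
assert (D := involutive_form_IV_deriv01 T c beta phi hbeta_cont
  (proj1 hphi) hform (proj2 hT)).
assert (E : (beta t * Cconj (beta (phi t)))%C = RtoC 1).
{ assert (D1 := D (Defs.mkC1 _ is_C1_id) t).
  simpl in D1; rewrite !(deriv01_unique _ _ _ (is_deriv01_id _)) in D1.
  now rewrite Cmult_1_r in D1. }
split; [exact E |].
assert (D2 := D (Defs.mkC1 _ is_C1_sqr) t).
simpl in D2; rewrite !(deriv01_unique _ _ _ (is_deriv01_sqr _)) in D2.
rewrite E, Cmult_1_l in D2.
apply I01_ext; apply (f_equal fst) in D2; simpl in D2; lra.
Qed.
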